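(* Let $f:\mathbb{R}_+^N\to\mathbb{R}_+^N$ be a monotone and positively homogeneous map having a positive eigenvector (with positive eigenvalue), i.e. there are $u\in\mathbb{R}^N$ with all entries positive and $\lambda>0$ such that $f(u)=\lambda u$. Let $v^0\in\mathbb{R}_+^N$ be any vector with positive entries such that $\prod_{i=1}^N v^0_i=1$. Then the sequence $(v^k)_{k\geq 0}$ defined by the projective Krasnoselskii-Mann iteration $$v^{k+1}=\left[\frac{f(v^k)}{G[f(v^k)]}\circ v^k\right]^{1/2},\qquad k\geq 0,$$ converges towards an eigenvector of $f$, and $G(f(v^k))$ converges to $r(f)$ as $k\to\infty$.
   Context: $\mathbb{R}_+^N$ is the closed cone of vectors with nonnegative entries, with the entrywise order $\leq$. $f$ is monotone if $x\leq y\Rightarrow f(x)\leq f(y)$, and positively homogeneous (of degree one) if $f(\lambda x)=\lambda f(x)$ for all $\lambda>0$. $\circ$ denotes the entrywise product of vectors, $[\cdot]^{1/2}$ is the entrywise square root, and $G(x)=(x_1\cdots x_N)^{1/N}$ is the geometric mean of the entries of $x$. The spectral radius of $f$ is $r(f)=\lim_{k\to\infty}\|f^k(x)\|^{1/k}$ for any $x\in\operatorname{int}\mathbb{R}_+^N$ (independent of $x$ and of the norm). *)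

(* Defs.v *)
From HB Require Import structures.
From mathcomp Require Import all_boot all_order all_algebra.
From mathcomp Require Import all_classical all_reals all_analysis.

Set Implicit Arguments.
Unset Strict Implicit.
Unset Printing Implicit Defensive.

Import Order.TTheory GRing.Theory Num.Theory.
Import numFieldNormedType.Exports.

Local Open Scope classical_set_scope.
Local Open Scope ring_scope.

(* A self-map of the cone R_+^N is represented by a total function on
   'rV[R]_N preserving [nneg_cone]; [cone_monotone] and [cone_homogeneous]
   constrain it on the cone only, so its values elsewhere are irrelevant. *)

Definition nneg_cone (R : realType) (N : nat) : set 'rV[R]_N :=
  [set x | forall i, 0 <= x ord0 i].

Definition positive_vec (R : realType) (N : nat) (x : 'rV[R]_N) : Prop :=
  forall i, 0 < x ord0 i.

Definition entrywise_le (R : realType) (N : nat) (x y : 'rV[R]_N) : Prop :=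
  forall i, x ord0 i <= y ord0 i.

Definition cone_map (R : realType) (N : nat) (f : 'rV[R]_N -> 'rV[R]_N) : Prop :=
  forall x, nneg_cone x -> nneg_cone (f x).

Definition cone_monotone (R : realType) (N : nat)
    (f : 'rV[R]_N -> 'rV[R]_N) : Prop :=
  forall x y, nneg_cone x -> nneg_cone y ->
    entrywise_le x y -> entrywise_le (f x) (f y).

Definition cone_homogeneous (R : realType) (N : nat)
    (f : 'rV[R]_N -> 'rV[R]_N) : Prop :=
  forall (a : R) x, 0 < a -> nneg_cone x -> f (a *: x) = a *: f x.

Definition cone_eigenvector (R : realType) (N : nat)
    (f : 'rV[R]_N -> 'rV[R]_N) (w : 'rV[R]_N) : Prop :=
  [/\ nneg_cone w, w != 0 & exists mu : R, f w = mu *: w].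

Definition geomean (R : realType) (N : nat) (x : 'rV[R]_N) : R :=
  (\prod_(i < N) x ord0 i) `^ (N%:R^-1).

(* r = lim_k ||f^k x||^(1/k) for every x in the interior of the cone. The norm
   is the sup norm of 'rV[R]_N; all norms give the same limit. The index k = 0,
   for which 0%:R^-1 = 0, does not affect it. For N > 0 there is at most one
   such r. *)
Definition is_spectral_radius (R : realType) (N : nat)
    (f : 'rV[R]_N -> 'rV[R]_N) (r : R) : Prop :=
  forall x : 'rV[R]_N, positive_vec x ->
    `|iter k f x| `^ (k%:R^-1) @[k --> \oo] --> r.

Definition projective_KM_step (R : realType) (N : nat)
    (f : 'rV[R]_N -> 'rV[R]_N) (x : 'rV[R]_N) : 'rV[R]_N :=
  map_mx Num.sqrt (map2_mx *%R ((geomean (f x))^-1 *: f x) x).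

(* Main.v *)
(* In logarithmic coordinates x |-> ln (f (exp x)) - ln lambda is monotone and
   commutes with adding constants, so it is a sup-norm nonexpansive map T, with
   fixed point ln u. The projective iteration is, up to subtraction of the mean
   of the entries, the Krasnoselskii-Mann iteration y |-> (y + T y) / 2. The
   Goebel-Kirk inequality gives |T y_k - y_k| --> 0, a cluster point of (y_k)
   is then a fixed point of T, and Fejer monotonicity turns clustering into
   convergence. Finally lambda is the spectral radius because every positive
   vector lies between two positive multiples of u. *)
Require Import Defs.
From HB Require Import structures.
From mathcomp Require Import all_boot all_order all_algebra ring lra.
From mathcomp Require Import all_classical all_reals all_analysis.

Set Implicit Arguments.
Unset Strict Implicit.
Unset Printing Implicit Defensive.

Import Order.TTheory GRing.Theory Num.Theory.
Import numFieldNormedType.Exports.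

Local Open Scope classical_set_scope.
Local Open Scope ring_scope.

(** * Krasnoselskii-Mann iteration of a nonexpansive map on a normed space *)

Definition nonexpansive (R : realType) (V : normedModType R) (T : V -> V) : Prop :=
  forall x y, `|T x - T y| <= `|x - y|.

Definition krasnoselskii_step (R : realType) (V : normedModType R) (T : V -> V)
    (x : V) : V :=
  2^-1 *: (x + T x).

Section KrasnoselskiiMann.
Variables (R : realType) (V : normedModType R) (T : V -> V).
Hypothesis T_nonexp : nonexpansive T.

Let orbit (x : V) (n : nat) : V := iter n (krasnoselskii_step T) x.

Let half_add (x : V) : 2^-1 *: x + 2^-1 *: x = x.
Proof. by rewrite -scalerDl -[RHS]scale1r; congr (_ *: _); lra. Qed.

Lemma krasnoselskii_step_sub (x : V) :
  krasnoselskii_step T x - x = 2^-1 *: (T x - x).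
Proof.
rewrite /krasnoselskii_step -[X in _ - X]half_add scalerDr opprD addrACA subrr.
by rewrite add0r -scalerBr.
Qed.

Lemma sub_krasnoselskii_step (x : V) :
  T x - krasnoselskii_step T x = 2^-1 *: (T x - x).
Proof.
rewrite /krasnoselskii_step -[X in X - _]half_add scalerDr opprD addrACA subrr.
by rewrite addr0 -scalerBr.
Qed.

Lemma krasnoselskii_step_dist (x : V) :
  `|krasnoselskii_step T x - x| = 2^-1 * `|T x - x|.
Proof. by rewrite krasnoselskii_step_sub normrZ gtr0_norm. Qed.

Lemma krasnoselskii_step_le (x y : V) :
  `|krasnoselskii_step T x - y| <= 2^-1 * (`|x - y| + `|T x - y|).
Proof.
have -> : krasnoselskii_step T x - y = 2^-1 *: ((x - y) + (T x - y)).
  rewrite /krasnoselskii_step -[in LHS](half_add y) scalerDr opprD addrACA.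
  by rewrite -!scalerBr -scalerDr.
by rewrite normrZ gtr0_norm// ler_pM2l// ler_normD.
Qed.

(** The new point lies halfway between [x] and [T x]: it is half a residual away from [T x], and its
    image is also within half a residual of [T x] by nonexpansiveness. *)
Lemma krasnoselskii_residual_le (x : V) :
  `|T (krasnoselskii_step T x) - krasnoselskii_step T x| <= `|T x - x|.
Proof.
set y := krasnoselskii_step T x.
rewrite (le_trans (ler_distD (T x) _ _))// sub_krasnoselskii_step normrZ gtr0_norm//.
have := T_nonexp y x; rewrite krasnoselskii_step_dist; lra.
Qed.

Lemma krasnoselskii_fejer (p x : V) : T p = p ->
  `|krasnoselskii_step T x - p| <= `|x - p|.
Proof.
move=> Tp; have := krasnoselskii_step_le x p.
have := T_nonexp x p; rewrite Tp; lra.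
Qed.

Let residual (x : V) (n : nat) : R := `|T (orbit x n) - orbit x n|.

Lemma residual_noninc (x : V) (m n : nat) : (m <= n)%N ->
  residual x n <= residual x m.
Proof.
move=> /subnK <-; elim: (n - m)%N => // k IH.
by rewrite addSn (le_trans _ IH)// /residual /orbit iterS krasnoselskii_residual_le.
Qed.

Lemma orbit_fejer (p x : V) (m n : nat) : T p = p -> (m <= n)%N ->
  `|orbit x n - p| <= `|orbit x m - p|.
Proof.
move=> Tp /subnK <-; elim: (n - m)%N => // k IH.
by rewrite addSn (le_trans _ IH)// /orbit iterS krasnoselskii_fejer.
Qed.

Lemma orbit_drift (x : V) (i n : nat) :
  `|orbit x (i + n) - orbit x i| <= n%:R / 2 * residual x i.
Proof.
elim: n => [|n IH]; first by rewrite addn0 subrr normr0 !mul0r.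
have s : `|krasnoselskii_step T (orbit x (i + n)) - orbit x (i + n)| =
    2^-1 * residual x (i + n) by exact: krasnoselskii_step_dist.
have r : residual x (i + n) <= residual x i by apply: residual_noninc; rewrite leq_addr.
rewrite addnS (_ : orbit x _.+1 = krasnoselskii_step T (orbit x (i + n)))//.
have := ler_distD (orbit x (i + n)) (krasnoselskii_step T (orbit x (i + n))) (orbit x i).
rewrite s -[n.+1%:R]natr1; lra.
Qed.

(* If the residual barely decreases along the orbit, the right-hand side is close
   to a distance that stays bounded while the left-hand side grows with n. *)
Lemma goebel_kirk (x : V) (n i : nat) :
  (1 + n%:R / 2) * residual x i <=
  `|T (orbit x (i + n)) - orbit x i| +
  2 ^+ n * (residual x i - residual x (i + n)).
Proof.
elim: n i => [|n IH] i; first by rewrite addn0 subrr mulr0 mul0r !addr0 mul1r.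
have := IH i.+1; rewrite addSnnS.
(* The point of index i+1 is the midpoint of the point of index i and its image; the distance to
   that image is bounded through nonexpansiveness and the drift over n+1 steps. *)
have d : `|T (orbit x (i + n.+1)) - orbit x i.+1| <=
    2^-1 * (`|T (orbit x (i + n.+1)) - orbit x i| + n.+1%:R / 2 * residual x i).
  rewrite -normrN opprB.
  apply: (le_trans (krasnoselskii_step_le _ _)); rewrite ler_pM2l// lerD//.
    by rewrite distrC.
  by rewrite (le_trans (T_nonexp _ _))// distrC orbit_drift.
have r : residual x i.+1 <= residual x i by exact: residual_noninc.
(* Combining the induction hypothesis with [d] leaves (2^(n+1) - (n+2)) * (residual x i - residual x
   i.+1) >= 0, a product of two nonnegative factors. *)
have b : n.+2%:R <= 2 ^+ n.+1 :> R by rewrite -natrX ler_nat ltn_expl.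
rewrite exprS -[n.+2%:R]natr1 -[n.+1%:R]natr1 in d b *; nra.
Qed.

Lemma asymptotic_regularity (p x : V) : T p = p ->
  residual x n @[n --> \oo] --> 0.
Proof.
move=> Tp.
have cv : cvgn (residual x).
  apply: nonincreasing_is_cvgn; first by move=> m n; exact: residual_noninc.
  by exists 0 => _ [n _ <-]; exact: normr_ge0.
set d := limn (residual x) in cv *.
suff -> : 0 = d by [].
have d_ge0 : 0 <= d by apply: limr_ge => //; near=> n; exact: normr_ge0.
apply/eqP; rewrite eq_le d_ge0 /= leNgt; apply/negP => d_gt0.
set M : R := 2 * `|x - p|.
(* For fixed n, let i tend to infinity in [goebel_kirk]: the difference of residuals vanishes, and
   the remaining distance is at most [M] because both points stay within [|x - p|] of [p]. *)
have bnd n : (1 + n%:R / 2) * d <= M.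
  have c1 : (1 + n%:R / 2) * residual x i @[i --> \oo] --> (1 + n%:R / 2) * d.
    by apply: cvgMr; exact: cv.
  have c2 : M + 2 ^+ n * (residual x i - residual x (i + n)) @[i --> \oo] -->
      M + 2 ^+ n * (d - d).
    apply: cvgD; first exact: cvg_cst.
    apply: cvgMr; apply: cvgB; first exact: cv.
    by rewrite cvg_shiftn; exact: cv.
  rewrite subrr mulr0 addr0 in c2.
  apply: (ler_cvg_to c1 c2); near=> i.
  apply: (le_trans (goebel_kirk x n i)); rewrite lerD2r.
  have h1 : `|T (orbit x (i + n)) - p| <= `|x - p|.
    by rewrite -{1}Tp (le_trans (T_nonexp _ _))// (orbit_fejer x Tp (leq0n _)).
  have h2 : `|orbit x i - p| <= `|x - p| by rewrite (orbit_fejer x Tp (leq0n i)).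
  rewrite (le_trans (ler_distD p _ _))// [`|p - _|]distrC /M; lra.
(* A value of n above 2M/d makes n * d / 2 exceed M. *)
have := bnd (Num.truncn (2 * M / d)).+1.
have := truncnS_gt (2 * M / d); rewrite ltr_pdivrMr//.
suff contra (a b t : R) : 0 < a -> 2 * b < t * a -> (1 + t / 2) * a <= b -> False.
  exact: contra.
by nra.
Unshelve. all: by end_near.
Qed.

End KrasnoselskiiMann.

(** * Convergence of the iteration in finite dimension *)

Lemma rV_norm_le (R : realType) (N : nat) (x : 'rV[R]_N) (e : R) : 0 <= e ->
  (`|x| <= e) <-> (forall i, `|x ord0 i| <= e).
Proof.
move=> e0; rewrite -[`|x|]/(mx_norm x) mx_normrE; split => [h i|h].
  by apply: le_trans h; apply: (le_bigmax _ _ (ord0, i)).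
by apply: bigmax_le => //= -[i j] _; rewrite (ord1 i) /=.
Qed.

Lemma krasnoselskii_mann_cvg (R : realType) (N : nat) (T : 'rV[R]_N -> 'rV[R]_N)
    (p x : 'rV[R]_N) : nonexpansive T -> T p = p ->
  exists2 q, T q = q & iter n (krasnoselskii_step T) x @[n --> \oo] --> q.
Proof.
move=> T_nonexp Tp; set y := fun n => iter n (krasnoselskii_step T) x.
have reg := asymptotic_regularity T_nonexp x Tp.
(* Fejer monotonicity traps the orbit in a compact ball around [p]; the added 1 keeps the radius
   positive when [x = p]. *)
have [q [_ q_cl]] : exists q, (closed_ball p (`|x - p| + 1) `&` cluster (y @ \oo)) q.
  apply: bounded_closed_compact.
  - exists (`|p| + (`|x - p| + 1)); split; first exact: num_real.
    move=> M ltM z; rewrite closed_ballE ?ltr_pwDr// /closed_ball_ /= => zp.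
    apply: le_trans (ltW ltM); rewrite -[z](subrK p) addrC (le_trans (ler_normD _ _))//.
    by rewrite lerD2l distrC.
  - exact: closed_ball_closed.
  - exists 0%N => // n _; rewrite /= closed_ballE ?ltr_pwDr// /closed_ball_ /= distrC.
    by rewrite (le_trans (orbit_fejer T_nonexp x Tp (leq0n n)))// lerDl.
have near_q (e : R) m : 0 < e -> exists2 n, (m <= n)%N & `|y n - q| < e.
  move=> e0.
  have [|_ [[n /= mn <-] yn]] :=
      q_cl (y @` [set n | (m <= n)%N]) (ball q e) _ (nbhsx_ballx _ _ e0).
    by exists m => // n /= mn; exists n.
  by exists n => //; rewrite distrC; move: yn; rewrite -ball_normE.
(* Go from [T q] to [T (y n)], to [y n], to [q]: two legs are small since [y n] is near [q], the
   middle one by asymptotic regularity. *)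
have Tq : T q = q.
  apply/eqP; rewrite -subr_eq0 -normr_le0; apply/ler_addgt0Pr => e e0.
  have e3_gt0 : 0 < e / 3 by rewrite divr_gt0.
  have [m _ hm] := (proj1 (cvgrPdist_lt _ _) reg) _ e3_gt0.
  have [n mn yq] := near_q (e / 3) m e3_gt0.
  have := hm n mn; rewrite /= sub0r normrN normr_id -/(y n) => h.
  have := T_nonexp q (y n); rewrite distrC [`|q - _|]distrC distrC => h1.
  have := ler_distD (T (y n)) (T q) q; have := ler_distD (y n) (T (y n)) q.
  lra.
(* Since [q] is now known to be fixed, distances to [q] never increase: one iterate within e of [q]
   controls all later ones. *)
exists q => //; apply/cvgrPdist_lt => e e0.
have [m _ mq] := near_q e 0 e0.
near=> n; rewrite distrC; apply: le_lt_trans mq.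
by apply: orbit_fejer => //; near: n; exact: nbhs_infty_ge.
Unshelve. all: by end_near.
Qed.

Lemma cvg_rV (R : realType) (N : nat) (x : nat -> 'rV[R]_N) (l : 'rV[R]_N) :
  (forall i, x k ord0 i @[k --> \oo] --> l ord0 i) -> x k @[k --> \oo] --> l.
Proof.
move=> xl; apply/cvgrPdist_le => e e0.
have : \forall k \near \oo, forall i, `|l ord0 i - x k ord0 i| <= e.
  by apply: filter_forall => i; move/cvgrPdist_le : (xl i); exact.
apply: filterS => k h; apply/rV_norm_le; first exact: ltW.
by move=> i; rewrite !mxE.
Qed.

Lemma cvg_coord (R : realType) (N : nat) (x : nat -> 'rV[R]_N) (l : 'rV[R]_N)
    (i : 'I_N) :
  x k @[k --> \oo] --> l -> x k ord0 i @[k --> \oo] --> l ord0 i.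
Proof. by move=> xl; exact: (cvg_comp _ _ xl (@coord_continuous R 1 N ord0 i l)). Qed.

(** * Arithmetic mean and centering, the logarithmic form of the geometric mean *)

Definition mean (R : realType) (N : nat) (x : 'rV[R]_N) : R :=
  (\sum_(i < N) x ord0 i) / N%:R.

(** In logarithmic coordinates this is division by the geometric mean. *)
Definition center (R : realType) (N : nat) (x : 'rV[R]_N) : 'rV[R]_N :=
  x - const_mx (mean x).

Section Mean.
Variables (R : realType) (N : nat).
Hypothesis N_gt0 : (0 < N)%N.
Implicit Types (x y : 'rV[R]_N) (c : R).

Lemma meanD x y : mean (x + y) = mean x + mean y.
Proof.
by rewrite /mean -mulrDl -big_split; congr (_ / _); apply: eq_bigr => i _; rewrite mxE.
Qed.

Lemma meanZ c x : mean (c *: x) = c * mean x.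
Proof.
by rewrite /mean mulrA mulr_sumr; congr (_ / _); apply: eq_bigr => i _; rewrite mxE.
Qed.

Lemma mean_const c : mean (const_mx c : 'rV[R]_N) = c.
Proof.
rewrite /mean (eq_bigr (fun=> c)) => [|i _]; last by rewrite mxE.
by rewrite sumr_const card_ord -[c *+ N]mulr_natr mulfK// pnatr_eq0 -lt0n.
Qed.

Lemma meanB x y : mean (x - y) = mean x - mean y.
Proof. by rewrite -scaleN1r meanD meanZ mulN1r. Qed.

Lemma center_shiftE x : center x = x + const_mx (- mean x).
Proof. by apply/rowP => i; rewrite !mxE. Qed.

Lemma center_shift x c : center (x + const_mx c) = center x.
Proof.
by rewrite /center meanD mean_const; apply/rowP => i; rewrite !mxE; ring.
Qed.

Lemma cvg_mean (x : nat -> 'rV[R]_N) (l : 'rV[R]_N) :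
  x k @[k --> \oo] --> l -> mean (x k) @[k --> \oo] --> mean l.
Proof.
move=> xl; apply: cvgMl; apply: cvg_big => [|i _]; last exact: cvg_coord.
exact: add_continuous.
Qed.

Lemma geomean_exp x : geomean (map_mx expR x) = expR (mean x).
Proof.
rewrite /geomean /mean expRM expR_sum; congr (_ `^ _).
by apply: eq_bigr => i _; rewrite mxE.
Qed.

End Mean.

(** * Positive vectors, the order of the cone, and roots of geometric sequences *)

Lemma exp_vec_pos (R : realType) (N : nat) (x : 'rV[R]_N) :
  positive_vec (map_mx expR x).
Proof. by move=> i; rewrite mxE expR_gt0. Qed.

Lemma ln_vecK (R : realType) (N : nat) (x : 'rV[R]_N) : positive_vec x ->
  map_mx expR (map_mx (@ln R) x) = x.
Proof. by move=> x0; apply/rowP => i; rewrite !mxE lnK// posrE. Qed.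

Lemma positive_nneg (R : realType) (N : nat) (x : 'rV[R]_N) :
  positive_vec x -> nneg_cone x.
Proof. by move=> x0 i; exact: ltW. Qed.

Lemma positive_scale (R : realType) (N : nat) (c : R) (x : 'rV[R]_N) :
  0 < c -> positive_vec x -> positive_vec (c *: x).
Proof. by move=> c0 x0 i; rewrite mxE mulr_gt0. Qed.

Lemma positive_dominated (R : realType) (N : nat) (x y : 'rV[R]_N) :
  positive_vec x -> positive_vec y -> exists2 c, 0 < c & entrywise_le (c *: x) y.
Proof.
(* The sum [S] bounds every ratio x_i / y_i; adding 1 keeps the denominator positive even when N =
   0. *)
move=> x0 y0; set S := \sum_i x ord0 i / y ord0 i.
have S0 : 0 <= S by apply: sumr_ge0 => i _; rewrite divr_ge0// ltW.
exists (1 + S)^-1; first by rewrite invr_gt0 ltr_pwDl.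
move=> i; rewrite mxE mulrC ler_pdivrMr ?ltr_pwDl// mulrC -ler_pdivrMr//.
rewrite /S (bigD1 i)//= addrCA lerDl addr_ge0// sumr_ge0// => j _.
by rewrite divr_ge0// ltW.
Qed.

Lemma entrywise_le_norm (R : realType) (N : nat) (x y : 'rV[R]_N) :
  nneg_cone x -> entrywise_le x y -> `|x| <= `|y|.
Proof.
move=> x0 xy; apply/rV_norm_le => // i; rewrite ger0_norm//.
have := proj1 (rV_norm_le y (normr_ge0 _)) (lexx _) i.
by apply: le_trans; rewrite (le_trans (xy i)) ?ler_norm.
Qed.

Lemma cvg_root_geometric (R : realType) (a b : R) : 0 < a -> 0 < b ->
  (a * b ^+ k) `^ k%:R^-1 @[k --> \oo] --> b.
Proof.
(* The shift skips k = 0, where the exponent [0%:R^-1] is 0 and the closed form below fails in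
   general. *)
move=> a0 b0; rewrite -cvg_shiftS /=.
have -> : (fun k => (a * b ^+ k.+1) `^ k.+1%:R^-1) =
    (fun k => expR (k.+1%:R^-1 * ln a) * b).
  apply/funext => k; rewrite powRM ?exprn_ge0 ?ltW// -powR_mulrn ?ltW//.
  by rewrite -powRrM mulfV ?pnatr_eq0// powRr1 ?ltW// /powR gt_eqF.
suff : expR (k.+1%:R^-1 * ln a) * b @[k --> \oo] --> expR (0 * ln a) * b.
  by rewrite mul0r expR0 mul1r.
apply: cvgMl; apply: continuous_cvg; first exact: continuous_expR.
by apply: cvgMl; exact: cvg_harmonic.
Qed.

(** * The map in logarithmic coordinates *)

Section LogMap.
Variables (R : realType) (N : nat) (f : 'rV[R]_N -> 'rV[R]_N).
Hypotheses (f_mono : cone_monotone f) (f_homog : cone_homogeneous f).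
Variables (u : 'rV[R]_N) (lambda : R).
Hypotheses (u_pos : positive_vec u) (lambda_gt0 : 0 < lambda).
Hypothesis fu : f u = lambda *: u.

(** As [x] dominates some [c *: u], its image dominates [c * lambda] times [u]. This is what makes
    taking logarithms of [f x] legitimate. *)
Lemma image_positive (x : 'rV[R]_N) : positive_vec x -> positive_vec (f x).
Proof.
move=> x0 i; have [c c0 cux] := positive_dominated u_pos x0.
have := f_mono (positive_nneg (positive_scale c0 u_pos)) (positive_nneg x0) cux.
move=> /(_ i); apply: lt_le_trans.
by rewrite f_homog ?fu ?mxE ?mulr_gt0//; exact: positive_nneg.
Qed.

Definition log_map (x : 'rV[R]_N) : 'rV[R]_N :=
  map_mx (@ln R) (f (map_mx expR x)) - const_mx (ln lambda).

Lemma exp_log_map (x : 'rV[R]_N) :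
  f (map_mx expR x) = map_mx expR (log_map x + const_mx (ln lambda)).
Proof. by rewrite subrK ln_vecK//; apply: image_positive; exact: exp_vec_pos. Qed.

Lemma log_map_fixed : log_map (map_mx (@ln R) u) = map_mx (@ln R) u.
Proof.
apply/rowP => i; rewrite /log_map ln_vecK// fu !mxE lnM ?posrE//.
by rewrite addrC addKr.
Qed.

Lemma exp_vec_shift (x : 'rV[R]_N) (c : R) :
  map_mx expR (x + const_mx c) = expR c *: map_mx expR x.
Proof. by apply/rowP => i; rewrite !mxE expRD mulrC. Qed.

Lemma log_map_shift (x : 'rV[R]_N) (c : R) :
  log_map (x + const_mx c) = log_map x + const_mx c.
Proof.
have fx0 := image_positive (exp_vec_pos x).
apply/rowP => i; rewrite /log_map exp_vec_shift f_homog ?expR_gt0//.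
  by rewrite !mxE lnM ?posrE ?expR_gt0// expRK; ring.
exact/positive_nneg/exp_vec_pos.
Qed.

Lemma log_map_mono (x y : 'rV[R]_N) :
  entrywise_le x y -> entrywise_le (log_map x) (log_map y).
Proof.
move=> xy i; rewrite !mxE lerD2r ler_ln ?posrE; last 2 first.
- exact/image_positive/exp_vec_pos.
- exact/image_positive/exp_vec_pos.
apply: f_mono; [exact/positive_nneg/exp_vec_pos..|].
by move=> j; rewrite !mxE ler_expR.
Qed.

(** Apply monotonicity to x <= y + |x - y|, pull the constant out of [log_map], then exchange [x]
    and [y]. *)
Lemma log_map_nonexpansive : nonexpansive log_map.
Proof.
have half (x y : 'rV[R]_N) i : log_map x ord0 i - log_map y ord0 i <= `|x - y|.
  have /(_ i) : entrywise_le (log_map x) (log_map (y + const_mx `|x - y|)).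
    apply: log_map_mono => j; rewrite !mxE.
    have := proj1 (rV_norm_le (x - y) (normr_ge0 _)) (lexx _) j.
    by rewrite !mxE ler_norml => /andP[_]; rewrite lerBlDl.
  rewrite log_map_shift; move: (log_map x) (log_map y) => a b.
  by rewrite !mxE lerBlDl.
move=> x y; apply/rV_norm_le => // i; have := half y x i; have := half x y i.
rewrite [`|y - x|]distrC; move: (log_map x) (log_map y) => a b.
by rewrite !mxE ler_norml lerNl opprB => -> ->.
Qed.

Lemma krasnoselskii_step_shift (x : 'rV[R]_N) (c : R) :
  krasnoselskii_step log_map (x + const_mx c) =
  krasnoselskii_step log_map x + const_mx c.
Proof.
by rewrite /krasnoselskii_step log_map_shift; apply/rowP => i; rewrite !mxE; field.
Qed.

Lemma projective_KM_step_log (N_gt0 : (0 < N)%N) (x : 'rV[R]_N) :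
  projective_KM_step f (map_mx expR (center x)) =
  map_mx expR (center (krasnoselskii_step log_map x)).
Proof.
(* Shifts commute with the step and are erased by [center], so the starting point may be taken with
   mean zero. *)
have -> : center (krasnoselskii_step log_map x) =
    center (krasnoselskii_step log_map (center x)).
  by rewrite [center x]center_shiftE krasnoselskii_step_shift center_shift.
have : mean (center x) = 0 by rewrite meanB mean_const// subrr.
move: (center x) => z z0; rewrite /projective_KM_step exp_log_map geomean_exp.
(* The factor [lambda] cancels in the division by the geometric mean; both sides become exp ((z + t
   - mean t) / 2) with t = [log_map z]. *)
rewrite /center /krasnoselskii_step meanZ !meanD mean_const// z0 add0r.
move: (log_map z) => t; apply/rowP => i; rewrite !mxE.
rewrite -expRN -!expRD -powR12_sqrt ?expR_ge0// -expRM.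
by congr expR; field.
Qed.

Lemma log_map_center (x : 'rV[R]_N) :
  log_map (center x) = log_map x + const_mx (- mean x).
Proof. by rewrite center_shiftE log_map_shift. Qed.

Lemma exp_fixed_eigenvector (x : 'rV[R]_N) : log_map x = x ->
  f (map_mx expR x) = lambda *: map_mx expR x.
Proof. by move=> xfix; rewrite exp_log_map xfix exp_vec_shift lnK. Qed.

(** * The eigenvalue as spectral radius *)

Lemma iter_positive (x : 'rV[R]_N) (k : nat) :
  positive_vec x -> positive_vec (iter k f x).
Proof. by move=> x0; elim: k => //= k IH; exact: image_positive. Qed.

Lemma iter_mono (x y : 'rV[R]_N) (k : nat) : positive_vec x -> positive_vec y ->
  entrywise_le x y -> entrywise_le (iter k f x) (iter k f y).
Proof.
move=> x0 y0 xy; elim: k => //= k IH.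
by apply: f_mono => //; apply/positive_nneg/iter_positive.
Qed.

Lemma iter_eigenvector (c : R) (k : nat) : 0 < c ->
  iter k f (c *: u) = (c * lambda ^+ k) *: u.
Proof.
move=> c0; elim: k => [|k IH]; first by rewrite mulr1.
rewrite iterS IH f_homog ?mulr_gt0 ?exprn_gt0//; last exact: positive_nneg.
by rewrite fu scalerA exprSr mulrA.
Qed.

Lemma eigenvalue_spectral_radius (N_gt0 : (0 < N)%N) : is_spectral_radius f lambda.
Proof.
have u_norm_gt0 : 0 < `|u|.
  rewrite normr_gt0; apply/eqP => u0.
  by have := u_pos (Ordinal N_gt0); rewrite u0 mxE ltxx.
move=> x x_pos.
have [c c0 cux] := positive_dominated u_pos x_pos.
have [d d0 dxu] := positive_dominated x_pos u_pos.
have xdu : entrywise_le x (d^-1 *: u).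
  by move=> i; rewrite mxE mulrC ler_pdivlMr// mulrC; have := dxu i; rewrite mxE.
(* On multiples of [u] the norms of the iterates are exactly geometric of ratio [lambda]; c u <= x
   <= d^-1 u transfers this to [x]. *)
apply: (@squeeze_cvgr _ _ _ _ (fun k => (c * `|u| * lambda ^+ k) `^ k%:R^-1)
  (fun k => (d^-1 * `|u| * lambda ^+ k) `^ k%:R^-1)).
- near=> k; have iter_norm b : 0 < b -> `|iter k f (b *: u)| = b * `|u| * lambda ^+ k.
    move=> b0; rewrite iter_eigenvector// normrZ gtr0_norm ?mulr_gt0 ?exprn_gt0//.
    by rewrite mulrAC.
  have pos_norm (a b : 'rV[R]_N) : positive_vec a -> positive_vec b ->
      entrywise_le a b -> `|iter k f a| <= `|iter k f b|.
    move=> a0 b0 ab; apply: entrywise_le_norm (iter_mono k a0 b0 ab).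
    exact/positive_nneg/iter_positive.
  have du : 0 < d^-1 by rewrite invr_gt0.
  by rewrite -!iter_norm// !ge0_ler_powR ?nnegrE ?invr_ge0 ?ler0n// pos_norm//;
    exact: positive_scale.
- by apply: cvg_root_geometric => //; rewrite mulr_gt0.
- by apply: cvg_root_geometric => //; rewrite mulr_gt0 ?invr_gt0.
Unshelve. all: by end_near.
Qed.

End LogMap.

Theorem theorem11 (R : realType) (N : nat) (N_gt0 : (0 < N)%N)
    (f : 'rV[R]_N -> 'rV[R]_N)
    (f_cone : cone_map f) (f_mono : cone_monotone f)
    (f_homog : cone_homogeneous f)
    (f_eigen : exists (u : 'rV[R]_N) (lambda : R),
       [/\ positive_vec u, 0 < lambda & f u = lambda *: u])
    (v0 : 'rV[R]_N) (v0_pos : positive_vec v0)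
    (v0_prod : \prod_(i < N) v0 ord0 i = 1)
    (v : nat -> 'rV[R]_N) (v_init : v 0%N = v0)
    (v_step : forall k : nat, v k.+1 = projective_KM_step f (v k)) :
  (exists w : 'rV[R]_N, cone_eigenvector f w /\ (v k @[k --> \oo] --> w)) /\
  (exists r : R,
     is_spectral_radius f r /\ (geomean (f (v k)) @[k --> \oo] --> r)).
Proof.
have [u [lambda [u_pos lambda_gt0 fu]]] := f_eigen.
pose T := log_map f lambda.
have T_nonexp : nonexpansive T by exact: (log_map_nonexpansive f_mono f_homog u_pos).
have Tu : T (map_mx (@ln R) u) = map_mx (@ln R) u by exact: log_map_fixed.
have [q Tq yq] := krasnoselskii_mann_cvg (map_mx (@ln R) v0) T_nonexp Tu.
set y := fun k => iter k _ _ in yq.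
have vE k : v k = map_mx expR (center (y k)).
  elim: k => [|k IH]; last first.
    by rewrite v_step IH (projective_KM_step_log f_mono f_homog u_pos lambda_gt0 fu).
  (* The normalization of [v0] says that its logarithm is already centered. *)
  have mean0 : mean (y 0%N) = 0.
    apply: expR_inj; rewrite expR0 -geomean_exp ln_vecK//.
    by rewrite /geomean v0_prod powR1.
  rewrite v_init -[LHS]ln_vecK//; congr map_mx.
  by apply/rowP => i; rewrite /center mean0 !mxE subr0.
have cvg_mean_y := cvg_mean yq.
split.
  exists (map_mx expR (center q)); split.
    split; first exact/positive_nneg/exp_vec_pos.
      apply/eqP => w0; have := exp_vec_pos (center q) (Ordinal N_gt0).
      by rewrite w0 mxE ltxx.
    exists lambda; apply: (exp_fixed_eigenvector f_mono f_homog u_pos) => //.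
    (* Centering a fixed point gives a fixed point, because [T] commutes with shifts. *)
    by rewrite (log_map_center f_mono f_homog u_pos)// -/T Tq -center_shiftE.
  apply: cvg_rV => i; rewrite mxE.
  under eq_fun do rewrite vE mxE.
  apply: continuous_cvg; first exact: continuous_expR.
  rewrite /center !mxE; under eq_fun do rewrite !mxE.
  by apply: cvgB => //; exact: cvg_coord.
exists lambda; split.
  exact: (eigenvalue_spectral_radius f_mono f_homog u_pos lambda_gt0 fu).
have Tyq : T (y k) @[k --> \oo] --> q.
  apply/cvgrPdist_le => e e0.
  move/cvgrPdist_le : yq => /(_ e e0); apply: filterS => k; apply: le_trans.
  by rewrite -{1}Tq.
(* Centering [y k] removes its mean from that of [T (y k)], so G(f(v_k)) differs from [lambda] only
   by the exponential of the mean of the residual vector, which tends to 0. *)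
have fvE k : geomean (f (v k)) = expR (mean (T (y k)) - mean (y k)) * lambda.
  rewrite vE (exp_log_map f_mono f_homog u_pos lambda_gt0 fu) geomean_exp.
  rewrite (log_map_center f_mono f_homog u_pos lambda_gt0 fu).
  by rewrite !meanD !mean_const// expRD lnK.
under eq_fun do rewrite fvE.
suff : expR (mean (T (y k)) - mean (y k)) * lambda @[k --> \oo] -->
    expR (mean q - mean q) * lambda by rewrite subrr expR0 mul1r.
apply: cvgMl; apply: continuous_cvg; first exact: continuous_expR.
by apply: cvgB => //; exact: cvg_mean.
Qed.
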